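(* Let $s \ge 2$ and $d \ge 1$. Up to similarity (isometry and scaling), there are only finitely many $s$-distance sets $X$ in $\mathbb{R}^d$ with $|X| \ge 2\binom{d+s-1}{s-1} + 2\binom{d+s-2}{s-2}$.
   Context: A finite set $X \subset \mathbb{R}^d$ is called an $s$-distance set if $|A(X)| = s$, where $A(X) = \{ d(x,y) : x, y \in X, x \neq y\}$ and $d(x,y)$ is the Euclidean distance. *)

(* Defs.v *)
From HB Require Import structures.
From mathcomp Require Import all_boot all_order all_algebra.
From mathcomp Require Import finmap.
From mathcomp Require Import reals.
Set Implicit Arguments. Unset Strict Implicit. Unset Printing Implicit Defensive.
Import Order.TTheory GRing.Theory Num.Theory.
Local Open Scope ring_scope.
Local Open Scope fset_scope.

Definition edist (R : realType) (d : nat) (x y : 'rV[R]_d) : R :=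
  Num.sqrt (\sum_(i < d) (x ord0 i - y ord0 i) ^+ 2).

Definition dist_set (R : realType) (d : nat) (X : {fset 'rV[R]_d}) : {fset R} :=
  [fset edist x y | x in X, y in X & x != y].

Definition is_s_distance_set (R : realType) (d s : nat) (X : {fset 'rV[R]_d}) : Prop :=
  #|` dist_set X| = s.

Definition similar_sets (R : realType) (d : nat) (X Y : {fset 'rV[R]_d}) : Prop :=
  exists (f : 'rV[R]_d -> 'rV[R]_d) (c : R), 0 < c /\
    (forall x y, edist (f x) (f y) = c * edist x y) /\
    [fset f x | x in X] = Y.

(* Main.v *)
(* Normalise the squared distances to b_0 < .. < b_m = 1, with m = s - 1, and let K_i be the value
   at 0 of the i-th Lagrange basis polynomial at the nodes b_j.  Evaluating that polynomial at the
   squared distances of the points gives the matrix K_i I + A_i, where A_i is the 0/1 adjacency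
   matrix of the i-th distance; polynomials of degree m in |x - y|^2 give matrices of rank at most
   N = C(d+m, m) + C(d+m-1, m-1) < |X|, so -K_i is an eigenvalue of A_i.  The same rank bound in
   degree s bounds |X|, so there are finitely many A_i, hence finitely many K_i (their integrality
   is not needed).

   The K_i determine the nodes up to finitely many choices: sum K_i p(b_i) = p(0) for deg p <= m.
   Rolle's theorem shows that the increments of such p over m disjoint intervals are independent.
   Hence the partial sums of K avoid 1, which bounds the gaps between the nodes from below, and two
   solutions that are closer than these gaps are equal.  So finitely many distance matrices occur
   up to scaling, and a correspondence of points preserving distances extends to an isometry. *)
Require Import Defs.
From HB Require Import structures.
From mathcomp Require Import all_boot all_order all_algebra.
From mathcomp Require Import finmap.
From mathcomp Require Import boolp reals.
From mathcomp Require Import polyrcf zify ring lra.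
Set Implicit Arguments. Unset Strict Implicit. Unset Printing Implicit Defensive.
Import Order.TTheory GRing.Theory Num.Theory.
Local Open Scope fset_scope.
Local Open Scope ring_scope.

(** * Preliminaries: finite sets of values, representatives, a product inequality *)

(** The covering list may contain further elements, so no decision procedure for [Q] is involved. *)
Definition finitely_many (T : eqType) (Q : T -> Prop) : Prop :=
  exists L : seq T, forall t, Q t -> t \in L.

Lemma finitely_many_union (F : finType) (T : eqType) (Q : F -> T -> Prop) :
  (forall x, finitely_many (Q x)) -> finitely_many (fun t => exists x, Q x t).
Proof.
move=> /fin_all_exists [L LP]; exists (flatten [seq L x | x <- enum F]).
move=> t [x Qxt]; apply/flatten_mapP; exists x; first by rewrite mem_enum.
exact: LP.
Qed.

(** One member of [P] is chosen for each value of [inv] attained on [P]; the other values get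
    [None]. This serves both for node sequences and for distance sets. *)
Lemma finite_representatives (T : Type) (F : finType) (P : T -> Prop)
    (inv : T -> F) (sim : T -> T -> Prop) :
  (forall x y, P x -> P y -> inv x = inv y -> sim x y) ->
  exists rep : F -> option T, forall x, P x -> exists2 y, rep (inv x) = Some y & sim x y.
Proof.
move=> simP.
have /fin_all_exists [rep repP] (v : F) : exists o : option T,
    forall x, P x -> inv x = v -> exists2 y, o = Some y & P y /\ inv y = v.
  have [[y [Py yv]]|none] := pselect (exists y, P y /\ inv y = v).
    by exists (Some y) => x _ _; exists y.
  by exists None => x Px xv; case: none; exists x.
exists rep => x Px; have [y ry [Py yx]] := repP _ x Px erefl.
by exists y => //; apply: simP.
Qed.

(** The union bound for independent events with probabilities [t i]. *)
Lemma prod_one_sub_bounds (R : realFieldType) (I : finType) (P : pred I) (t : I -> R) :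
  (forall i, P i -> 0 <= t i <= 1) ->
  0 <= 1 - \prod_(i | P i) (1 - t i) <= \sum_(i | P i) t i.
Proof.
move=> t01; pose good y x := [/\ 0 <= y, y <= 1 & 1 - y <= x :> R].
suff [_ y1 yx] : good (\prod_(i | P i) (1 - t i)) (\sum_(i | P i) t i) by rewrite subr_ge0 y1.
elim/big_rec2: _ => [|i x y Pi [x0 x1 xy]]; first by split; rewrite ?subrr.
by have /andP[t0 t1] := t01 i Pi; split; nra.
Qed.

(** * Rolle's theorem and independence of increments *)

Lemma exists_root_in_interval_of_deriv (R : rcfType) (a b : R) (p : {poly R}) :
  a < b -> p.[a] = p.[b] -> exists2 c, a < c < b & root p^`() c.
Proof.
move=> lt_ab pab; have [c] := poly_mvt p lt_ab.
rewrite in_itv /= => c_in /eqP; rewrite pab subrr eq_sym mulf_eq0 subr_eq0.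
by rewrite [b == a]gt_eqF // orbF => c0; exists c.
Qed.

(* Rolle on m disjoint intervals gives the derivative m roots. *)
Lemma deriv_eq0_of_equal_ends (R : rcfType) (m : nat) (u v : nat -> R) (p : {poly R}) :
  (forall i, (i < m)%N -> u i < v i) ->
  (forall i, (i.+1 < m)%N -> v i <= u i.+1) ->
  (size p <= m.+1)%N -> (forall i, (i < m)%N -> p.[u i] = p.[v i]) -> p^`() = 0.
Proof.
move=> uv vu sp puv.
have /fin_all_exists [c cP] (i : 'I_m) : exists c, u i < c < v i /\ root p^`() c.
  have [c c_in c0] := exists_root_in_interval_of_deriv (uv i (ltn_ord i)) (puv i (ltn_ord i)).
  by exists c.
have vu_far i j : (i < j)%N -> (j < m)%N -> v i <= u j.
  elim: j => // j IHj; rewrite ltnS leq_eqVlt => /predU1P[-> jm|ij jm]; first exact: vu.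
  apply: le_trans (IHj ij (ltnW jm)) _.
  exact: le_trans (ltW (uv j (ltnW jm))) (vu _ jm).
have c_inj : injective c.
  suff lt_c (i j : 'I_m) : (i < j)%N -> c i < c j.
    move=> i j cij; apply: val_inj; case: (ltngtP i j) => // /lt_c.
      by rewrite cij ltxx.
    by rewrite cij ltxx.
  move=> ij; have [/andP[_ civ] _] := cP i; have [/andP[ucj _] _] := cP j.
  exact: lt_le_trans civ (le_trans (vu_far _ _ ij (ltn_ord j)) (ltW ucj)).
apply: (@roots_geq_poly_eq0 _ _ (codom c)).
- by apply/allP => x /codomP[i ->]; case: (cP i).
- exact/injectiveP.
- rewrite size_codom card_ord; have [->|p0] := eqVneq p 0; first by rewrite deriv0 size_poly0.
  by rewrite -ltnS; apply: leq_trans (lt_size_deriv p0) sp.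
Qed.

(** The increments of ['X], .., ['X^m] form a square matrix. A vector in its left kernel gives a
    polynomial without constant term that takes equal values at the ends of each interval; its
    derivative vanishes, so it is 0. Hence the matrix is invertible. *)
Lemma interval_increments_independent (R : rcfType) (m : nat) (u v w : nat -> R) :
  (forall i, (i < m)%N -> u i < v i) ->
  (forall i, (i.+1 < m)%N -> v i <= u i.+1) ->
  (forall p : {poly R}, (size p <= m.+1)%N ->
     \sum_(i < m) w i * (p.[v i] - p.[u i]) = 0) ->
  forall i, (i < m)%N -> w i = 0.
Proof.
move=> uv vu wP.
pose A : 'M[R]_m := \matrix_(k, i) (v i ^+ k.+1 - u i ^+ k.+1).
have Aw : A *m (\col_i w i) = 0.
  apply/colP => k; rewrite !mxE -[RHS](wP 'X^(k.+1)) ?size_polyXn ?ltnS //.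
  by apply: eq_bigr => i _; rewrite !mxE !hornerXn mulrC.
have free_A : row_free A.
  apply: inj_row_free => a aA.
  pose p := rVpoly a * 'X.
  have pE x : p.[x] = \sum_k a 0 k * x ^+ k.+1.
    rewrite hornerMX horner_poly mulr_suml; apply: eq_bigr => k _.
    by rewrite valK exprSr mulrA.
  have dp : p^`() = 0.
    apply: (@deriv_eq0_of_equal_ends _ m u v) => //; first
      by apply: leq_trans (size_polyMleq _ _) _; rewrite size_polyX addn2 ltnS size_poly.
    move=> i im; apply/eqP; rewrite eq_sym -subr_eq0 !pE -sumrB; apply/eqP.
    have := congr1 (fun B : 'rV_m => B 0 (Ordinal im)) aA; rewrite !mxE => {2}<-.
    by apply: eq_bigr => k _; rewrite !mxE mulrBr.
  apply/rowP => k; have := congr1 (fun q : {poly R} => q`_k) dp.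
  rewrite coef_deriv coefMX /= coef_rVpoly_ord coef0 !mxE.
  by move/eqP; rewrite mulrn_eq0 => /eqP.
have uA : A \in unitmx by rewrite -row_free_unit.
have w0 : \col_i w i = 0 :> 'cV_m by rewrite -[LHS](mulKmx uA) Aw mulmx0.
by move=> i im; have := congr1 (fun B : 'cV_m => B (Ordinal im) 0) w0; rewrite !mxE.
Qed.

(** * Lagrange interpolation *)

Lemma size_prod_linear (R : idomainType) (I : finType) (P : pred I) (F : I -> {poly R}) :
  (forall i, P i -> (size (F i) <= 2)%N) -> (size (\prod_(i | P i) F i)%R <= #|P|.+1)%N.
Proof.
move=> F2; apply: leq_trans (size_prod_leq _ _) _; rewrite leq_subLR.
by rewrite addnS ltnS addnn -muln2 -sum_nat_const leq_sum.
Qed.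

(** The signs are chosen so that the value at 0 is the product of the [b j / (b j - b i)]. *)
Definition lagrange_basis (R : fieldType) (m : nat) (b : nat -> R) (i : nat) : {poly R} :=
  \prod_(j < m.+1 | j != i :> nat) ((b j - b i)^-1 *: ((b j)%:P - 'X)).

Lemma size_lagrange_basis (R : fieldType) (m : nat) (b : nat -> R) (i : nat) :
  (i <= m)%N -> (size (lagrange_basis m b i) <= m.+1)%N.
Proof.
move=> im; apply: leq_trans (size_prod_linear _) _.
  move=> j _; apply: leq_trans (size_scale_leq _ _) _.
  by rewrite -size_polyN opprB size_XsubC.
have := cardC1 (Ordinal (im : (i < m.+1)%N)); rewrite card_ord /= => card_m.
by rewrite ltnS -[leqRHS]card_m; apply: eq_leq; apply: eq_card => j; rewrite !inE.
Qed.

Lemma horner_lagrange_basis (R : fieldType) (m : nat) (b : nat -> R) (i : nat) (x : R) :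
  (lagrange_basis m b i).[x] = \prod_(j < m.+1 | j != i :> nat) ((b j - x) / (b j - b i)).
Proof. by rewrite horner_prod; apply: eq_bigr => j _; rewrite !hornerE mulrC. Qed.

Lemma lagrange_basis_node (R : fieldType) (m : nat) (b : nat -> R) (i j : nat) :
  {in gtn m.+1 &, injective b} -> (i <= m)%N -> (j <= m)%N ->
  (lagrange_basis m b i).[b j] = (i == j)%:R.
Proof.
move=> b_inj im jm; rewrite horner_lagrange_basis.
have [->|ij] := eqVneq i j.
  apply: big1 => k kj; rewrite divff // subr_eq0; apply: contra kj => /eqP /b_inj -> //.
  exact: (ltn_ord k).
rewrite (bigD1 (Ordinal (jm : (j < m.+1)%N))) /=; last by rewrite eq_sym.
by rewrite subrr !mul0r.
Qed.

(** Both sides, as polynomials in [x], have size at most [m.+1] and agree at [m.+1] distinct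
    nodes. *)
Lemma lagrange_interpolation (R : fieldType) (m : nat) (b : nat -> R) (p : {poly R}) (x : R) :
  {in gtn m.+1 &, injective b} -> (size p <= m.+1)%N ->
  \sum_(i < m.+1) (lagrange_basis m b i).[x] * p.[b i] = p.[x].
Proof.
move=> b_inj sp; pose q := \sum_(i < m.+1) p.[b i] *: lagrange_basis m b i.
have -> : p = q.
  apply/eqP; rewrite -subr_eq0; apply/eqP.
  apply: (@roots_geq_poly_eq0 _ _ [seq b i | i : 'I_m.+1]).
  - apply/allP => y /mapP[j _ ->]; rewrite rootE hornerD hornerN horner_sum subr_eq0 eq_sym.
    rewrite (bigD1 j) //= big1 ?addr0.
      by rewrite hornerZ lagrange_basis_node ?eqxx ?mulr1 ?leq_ord.
    move=> i ij; rewrite hornerZ lagrange_basis_node ?leq_ord //.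
    by rewrite (negPf ij : (i == j :> nat) = false) mulr0.
  - rewrite map_inj_uniq ?enum_uniq // => i j bij.
    by apply/val_inj/(b_inj _ _ _ _ bij); apply: ltn_ord.
  - rewrite size_map -cardE card_ord; apply: leq_trans (size_polyD _ _) _.
    rewrite geq_max sp size_polyN; apply: leq_trans (size_sum _ _ _) _.
    apply/bigmax_leqP => /= i _; apply: leq_trans (size_scale_leq _ _) _.
    by apply: size_lagrange_basis; apply: leq_ord.
rewrite [in RHS]horner_sum; apply: eq_bigr => i _; rewrite hornerZ mulrC; congr (_ * _).
rewrite horner_sum (bigD1 i) //= big1 ?addr0.
  by rewrite hornerZ lagrange_basis_node ?eqxx ?mulr1 ?leq_ord.
move=> j ij; rewrite hornerZ lagrange_basis_node ?leq_ord //.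
by rewrite (negPf ij : (j == i :> nat) = false) mulr0.
Qed.

(** * Node sequences with prescribed Lagrange weights at 0 *)

(** An inverse problem: [K] is given and the nodes [b] are sought. *)
Definition nodes_with_weights (R : realFieldType) (m : nat) (K b : nat -> R) : Prop :=
  [/\ forall i j, (i < j)%N -> (j <= m)%N -> b i < b j, 0 < b 0, b m = 1
    & forall i, (i <= m)%N -> K i = (lagrange_basis m b i).[0]].

Lemma nodes_inj (R : realFieldType) (m : nat) (b : nat -> R) :
  (forall i j, (i < j)%N -> (j <= m)%N -> b i < b j) -> {in gtn m.+1 &, injective b}.
Proof.
move=> b_lt i j; rewrite !unfold_in => im jm bij.
by case: (ltngtP i j) => // [/b_lt/(_ jm)|/b_lt/(_ im)]; rewrite bij ltxx.
Qed.

Lemma summation_by_parts (R : pzRingType) (K f : nat -> R) (n : nat) :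
  \sum_(i < n) K i * (f i.+1 - f 0%N) =
  \sum_(i < n) (\sum_(i <= j < n) K j) * (f i.+1 - f i).
Proof.
elim: n => [|n IHn]; first by rewrite !big_ord0.
under [RHS]eq_bigr => i _ do rewrite big_nat_recr ?leq_ord //= mulrDl.
rewrite [RHS]big_split /= -mulr_sumr -(big_mkord xpredT (fun i => f i.+1 - f i)).
rewrite telescope_sumr // [LHS]big_ord_recr IHn /=. congr (_ + _).
by rewrite big_ord_recr /= big_geq // mul0r addr0.
Qed.

Section NodesWithWeights.
Context (R : rcfType) (m : nat) (K : nat -> R).
Implicit Types (b c : nat -> R).
Local Notation sol := (nodes_with_weights m K).

(** This is Lagrange interpolation evaluated at 0. *)
Lemma weights_moment b (p : {poly R}) : sol b -> (size p <= m.+1)%N ->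
  \sum_(i < m.+1) K i * p.[b i] = p.[0].
Proof.
case=> b_lt _ _ KE sp; rewrite -(lagrange_interpolation _ (nodes_inj b_lt) sp).
by apply: eq_bigr => i _; rewrite KE ?leq_ord.
Qed.

Lemma nodes_gt0 b i : sol b -> (i <= m)%N -> 0 < b i.
Proof.
by case=> b_lt b0 _ _; case: i => // i im; apply: lt_trans b0 (b_lt _ _ _ im).
Qed.

Lemma nodes_le1 b i : sol b -> (i <= m)%N -> b i <= 1.
Proof.
case=> b_lt _ <- _; rewrite leq_eqVlt => /predU1P[->//|im].
exact: ltW (b_lt _ _ im _).
Qed.

Lemma weights_neq0 b i : sol b -> (i <= m)%N -> K i != 0.
Proof.
move=> solb im; have [b_lt _ _ KE] := solb.
rewrite KE // horner_lagrange_basis; apply/prodf_neq0 => j ji; rewrite subr0 mulf_neq0 //.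
  by rewrite gt_eqF // nodes_gt0 ?leq_ord.
rewrite invr_eq0 subr_eq0; apply: contra ji => /eqP/(nodes_inj b_lt) -> //.
exact: (ltn_ord j).
Qed.

(* Abel summation turns the moments into increments over the m+1 intervals [0, b_0],
   [b_0, b_1], .. with the tail sums of the weights as coefficients; a vanishing tail
   leaves only m intervals. *)
Lemma weights_tail_neq0 b k : sol b -> (0 < k <= m)%N -> \sum_(k <= j < m.+1) K j != 0.
Proof.
move=> solb /andP[k0 km]; apply/negP => /eqP Tk0.
pose T i := \sum_(i <= j < m.+1) K j.
have T0 : T 0%N = 1.
  have := weights_moment solb (p := 1); rewrite size_poly1 hornerC => <- //.
  by rewrite /T big_mkord; apply: eq_bigr => i _; rewrite hornerC mulr1.
pose B i := if i is i'.+1 then b i' else 0.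
have B_lt i j : (i < j)%N -> (j <= m.+1)%N -> B i < B j.
  have [b_lt _ _ _] := solb.
  by case: i j => [|i] [|j] //= ij jm; [exact: nodes_gt0|exact: b_lt].
have abel (p : {poly R}) : (size p <= m.+1)%N ->
    \sum_(i < m.+1) T i * (p.[B i.+1] - p.[B i]) = 0.
  move=> sp; rewrite -(summation_by_parts K (fun i => p.[B i])) /=.
  under eq_bigr do rewrite mulrBr.
  rewrite sumrB (weights_moment solb sp) -mulr_suml -(big_mkord xpredT).
  by rewrite [\sum_(0 <= i < _) _]T0 mul1r subrr.
have ord_k : (k < m.+1)%N by [].
(* [bump k] lists the indices other than [k]. As [k > 0], it fixes 0, where the tail is the full sum
   1; this gives the contradiction. *)
pose h := bump k.
have hP : forall p : {poly R}, (size p <= m.+1)%N ->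
    \sum_(i < m) T (h i) * (p.[B (h i).+1] - p.[B (h i)]) = 0.
  by move=> p /abel; rewrite (bigD1_ord (Ordinal ord_k)) //= [T k]Tk0 mul0r add0r.
have T_h0 := @interval_increments_independent _ _ (fun i => B (h i)) (fun i => B (h i).+1)
  (fun i => T (h i)) _ _ hP.
have : T (h 0%N) = 0.
  apply: T_h0; last exact: leq_trans k0 km.
    by move=> i im; apply: B_lt => //; rewrite /h /bump; lia.
  move=> i im; have : ((h i).+1 <= h i.+1)%N by rewrite /h /bump; lia.
  rewrite leq_eqVlt => /predU1P[->//|lt_h]; apply/ltW/B_lt => //.
  by rewrite /h /bump; lia.
by rewrite /h /bump leqNgt k0 T0 => /eqP; rewrite oner_eq0.
Qed.


Lemma weights_le_total i : (i <= m)%N -> `|K i| <= 1 + \sum_(j < m.+1) `|K j|.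
Proof.
move=> im; rewrite (bigD1 (Ordinal (im : (i < m.+1)%N))) //=.
by rewrite addrCA ler_wpDr ?lexx // addr_ge0 ?sumr_ge0.
Qed.

Lemma weights_total_gt0 : 0 < 1 + \sum_(j < m.+1) `|K j|.
Proof. by rewrite ltr_pwDl // sumr_ge0. Qed.

(* If b_k were much smaller than b_(k+1), the polynomial 1 - prod_(j > k) (1 - x / b_j) would be
   nearly 0 at b_0, .., b_k, forcing the nonzero tail K_(k+1) + .. + K_m to be nearly 0. *)
Lemma consecutive_ratio_bound k : (exists b, sol b) -> (k < m)%N ->
  exists2 rho : R, 0 < rho & forall b, sol b -> rho * b k.+1 <= b k.
Proof.
move=> [b0 solb0] km; pose T := \sum_(k.+1 <= j < m.+1) K j.
have T0 : T != 0 by apply: weights_tail_neq0 solb0 _; rewrite km.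
(* The constant comes from bounding [|T|] by the sum of the [|K j|] times [(m + 1) * b k / b k.+1];
   the added 1 keeps [M] positive. *)
pose M := (1 + \sum_(j < m.+1) `|K j|) * m.+1%:R.
have M0 : 0 < M by rewrite mulr_gt0 ?ltr0n ?weights_total_gt0.
exists (`|T| / M); first by rewrite divr_gt0 ?normr_gt0.
move=> b solb; have [b_lt _ _ _] := solb.
have bk0 : 0 < b k.+1 by apply: nodes_gt0.
have bk : 0 < b k by apply: nodes_gt0 (ltnW km).
have bgt0 (j : 'I_m.+1) : 0 < b j by apply: nodes_gt0 solb (leq_ord j).
rewrite mulrAC ler_pdivrMr // -ler_pdivlMr //.
pose p : {poly R} := 1 - \prod_(j < m.+1 | (k < j)%N) (1 - (b j)^-1 *: 'X).
have pE x : p.[x] = 1 - \prod_(j < m.+1 | (k < j)%N) (1 - x / b j).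
  rewrite hornerD hornerN hornerC horner_prod; congr (_ - _); apply: eq_bigr => j _.
  by rewrite !hornerE mulrC.
have sp : (size p <= m.+1)%N.
  apply: leq_trans (size_polyD _ _) _; rewrite size_polyN geq_max size_poly1 /=.
  apply: leq_trans (size_prod_linear _) _.
    move=> j _; apply: leq_trans (size_polyD _ _) _; rewrite size_polyN geq_max size_poly1 /=.
    by apply: leq_trans (size_scale_leq _ _) _; rewrite size_polyX.
  (* Index 0 is never above [k], so at most [m] factors occur. *)
  rewrite ltnS -[leqRHS]/(m.+1.-1) -[m.+1 in leqRHS]card_ord -(cardC1 (ord0 : 'I_m.+1)).
  by apply: subset_leq_card; apply/subsetP => j; rewrite !inE unfold_in; case: j => -[].
have p_high (j : 'I_m.+1) : (k < j)%N -> p.[b j] = 1.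
  by move=> kj; rewrite pE (bigD1 j) //= divff ?gt_eqF // subrr mul0r subr0.
have p_low (j : 'I_m.+1) : (j <= k)%N -> `|p.[b j]| <= m.+1%:R * (b k / b k.+1).
  move=> jk; have t01 (i : 'I_m.+1) : (k < i)%N -> 0 <= b j / b i <= b k / b k.+1.
    move=> ki; apply/andP; split; first by apply: divr_ge0; apply: ltW.
    apply: ler_pM; rewrite ?invr_ge0; try exact: ltW.
      by move: jk; rewrite leq_eqVlt => /predU1P[->//|jk]; apply/ltW/b_lt/ltnW.
    rewrite lef_pV2 ?posrE //; move: ki; rewrite leq_eqVlt => /predU1P[->//|ki].
    by apply/ltW/b_lt; rewrite ?leq_ord.
  have /andP[p0 ps] : 0 <= p.[b j] <= \sum_(i < m.+1 | (k < i)%N) b j / b i.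
    rewrite pE; apply: prod_one_sub_bounds => i ki; have /andP[-> h] := t01 i ki.
    by apply: le_trans h _; rewrite ler_pdivrMr // mul1r; apply/ltW/b_lt.
  rewrite ger0_norm //; apply: le_trans ps _.
  apply: le_trans (_ : \sum_(i < m.+1) b k / b k.+1 <= _).
    rewrite big_mkcond; apply: ler_sum => i _.
    by case: ifP => [/t01/andP[]//|_]; apply: divr_ge0; apply: ltW.
  by rewrite sumr_const card_ord mulr_natl.
(* Since [p] is 0 at 0 and 1 at the nodes above [k], its moment identity expresses [T] by the lower
   nodes. *)
have TE : T = - \sum_(j < m.+1 | (j <= k)%N) K j * p.[b j].
  have := weights_moment solb sp; rewrite pE [X in _ - X]big1 ?subrr; last first.
    by move=> j _; rewrite mul0r subr0.
  rewrite (bigID (fun j : 'I_m.+1 => (j <= k)%N)) /= => /eqP; rewrite addr_eq0 => /eqP ->.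
  rewrite opprK /T big_geq_mkord; apply: eq_big => j; rewrite -?ltnNge // => kj.
  by rewrite p_high ?mulr1.
rewrite TE normrN -mulrA; apply: le_trans (ler_norm_sum _ _ _) _.
apply: le_trans (_ : \sum_(j < m.+1) `|K j| * (m.+1%:R * (b k / b k.+1)) <= _).
  rewrite big_mkcond; apply: ler_sum => j _; case: ifP => [jk|_].
    by rewrite normrM ler_wpM2l // p_low.
  by rewrite !mulr_ge0 ?invr_ge0 ?(ltW bk0) ?(ltW bk).
rewrite -mulr_suml.
have -> : b k * (M / b k.+1) = (1 + \sum_(j < m.+1) `|K j|) * (m.+1%:R * (b k / b k.+1)).
  by rewrite /M; ring.
apply: ler_wpM2r; last by rewrite lerDr.
by rewrite !mulr_ge0 ?invr_ge0 ?(ltW bk0) ?(ltW bk).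
Qed.

(** Descending from [b m = 1], each step multiplies the bound by the ratio constant, which depends
    on [K] but not on [b]. *)
Lemma nodes_lower_bound : (exists b, sol b) ->
  exists2 tau : R, 0 < tau & forall b, sol b -> forall i, (i <= m)%N -> tau <= b i.
Proof.
move=> ex_sol.
have H : forall j, (j <= m)%N -> exists2 tau : R, 0 < tau & forall b, sol b -> tau <= b (m - j)%N.
  elim=> [_|j IHj jm]; first by exists 1 => // b [_ _ bm _]; rewrite subn0 bm.
  have [tau tau0 tauP] := IHj (ltnW jm).
  have lt_m : (m - j.+1 < m)%N by lia.
  have [rho rho0 rhoP] := consecutive_ratio_bound ex_sol lt_m.
  exists (rho * tau); first exact: mulr_gt0.
  move=> b solb; apply: le_trans (rhoP b solb); rewrite ler_pM2l // -subSn // subSS.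
  exact: tauP.
have [tau tau0 tauP] := H m (leqnn m); rewrite subnn in tauP.
exists tau => // b solb i im; apply: le_trans (tauP b solb) _.
have [b_lt _ _ _] := solb.
by case: i im => // i im; apply/ltW/b_lt.
Qed.

(** [K i] is bounded and contains the factor [b j / (b j - b i)], while its other factors are
    bounded away from 0; so the denominator cannot be small. *)
Lemma nodes_gap : (exists b, sol b) ->
  exists2 delta : R, 0 < delta &
    forall b, sol b -> forall i j, (i < j)%N -> (j <= m)%N -> b i + delta <= b j.
Proof.
move=> ex_sol; have [tau tau0 tauP] := nodes_lower_bound ex_sol.
have tau1 : tau <= 1 by have [b solb] := ex_sol; have [_ _ <- _] := solb; apply: tauP.
pose M := 1 + \sum_(j < m.+1) `|K j|.
have M0 : 0 < M := weights_total_gt0.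
(* One [tau] bounds the numerator [b j]; the others bound the remaining factors, at most [m.+1] in
   number. *)
exists (tau ^+ m.+2 / M); first by rewrite divr_gt0 ?exprn_gt0.
move=> b solb i j ij jm; have [b_lt _ _ KE] := solb.
have im : (i <= m)%N := leq_trans (ltnW ij) jm.
have gap_gt0 : 0 < b j - b i by rewrite subr_gt0 b_lt.
have factor_ge (l : 'I_m.+1) : l != i :> nat -> tau <= `|b l / (b l - b i)|.
  move=> li; have bl := tauP b solb l (leq_ord l); have bi := tauP b solb i im.
  have bl1 := nodes_le1 solb (leq_ord l); have bi1 := nodes_le1 solb im.
  have dist_gt0 : 0 < `|b l - b i|.
    rewrite normr_gt0 subr_eq0; apply: contra li => /eqP/(nodes_inj b_lt) -> //.
    exact: (ltn_ord l).
  rewrite normf_div (ger0_norm (le_trans (ltW tau0) bl)) ler_pdivlMr //.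
  apply: (le_trans _ bl); rewrite ger_pMr //.
  by rewrite ler_norml; apply/andP; split; lra.
have Kle := weights_le_total im; rewrite -/M KE // horner_lagrange_basis in Kle.
rewrite (bigD1 (Ordinal (jm : (j < m.+1)%N))) /= ?gtn_eqF // subr0 normrM in Kle.
pose P (l : 'I_m.+1) := (l != i :> nat) && (l != Ordinal (jm : (j < m.+1)%N)).
have rest : tau ^+ m.+1 <= `|\prod_(l < m.+1 | P l) ((b l - 0) / (b l - b i))|.
  rewrite normr_prod; apply: le_trans (_ : \prod_(l < m.+1 | P l) tau <= _).
    rewrite prodr_const; apply: ler_wiXn2l => //; first exact: ltW.
    by apply: leq_trans (max_card _) _; rewrite card_ord.
  by apply: ler_prod => l /andP[li _]; rewrite ltW //= subr0 factor_ge.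
rewrite -lerBrDl ler_pdivrMr // exprS.
have first_factor : tau / (b j - b i) <= `|b j / (b j - b i)|.
  rewrite normf_div (gtr0_norm gap_gt0) ler_pM2r ?invr_gt0 //.
  exact: le_trans (tauP b solb j jm) (ler_norm _).
rewrite [leRHS]mulrC -ler_pdivrMr // mulrAC.
apply: le_trans Kle; apply: ler_pM => //; last exact: exprn_ge0 (ltW tau0).
by rewrite divr_ge0 // ltW.
Qed.

(* The increments from b_i to c_i have disjoint supports when b and c are close, so the
   difference of the moments of b and c vanishes only if all increments do. *)
Lemma close_nodes_eq (delta : R) b c : 0 < delta -> sol b -> sol c ->
  (forall i j, (i < j)%N -> (j <= m)%N -> b i + delta <= b j) ->
  (forall i j, (i < j)%N -> (j <= m)%N -> c i + delta <= c j) ->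
  (forall i, (i <= m)%N -> `|b i - c i| <= delta) ->
  forall i, (i <= m)%N -> b i = c i.
Proof.
move=> delta0 solb solc gap_b gap_c close.
have [_ _ bm _] := solb; have [_ _ cm _] := solc.
pose u i := Num.min (b i) (c i).
(* Where [b i = c i], a dummy interval of length [delta] with weight 0 keeps [u i < v i]. Elsewhere
   the sign in [w] makes up for the ordering of the two ends. *)
pose v i := if b i == c i then b i + delta else Num.max (b i) (c i).
pose w i := if b i == c i then 0 else if b i < c i then K i else - K i.
have wP (p : {poly R}) i : w i * (p.[v i] - p.[u i]) = K i * (p.[c i] - p.[b i]).
  by rewrite /w /v /u; case: (ltgtP (b i) (c i)) => [_|_|->]; rewrite ?subrr; ring.
have v_le i : (i <= m)%N -> v i <= b i + delta /\ v i <= c i + delta.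
  move=> /close; rewrite ler_norml => /andP[? ?]; rewrite /v.
  by case: (ltgtP (b i) (c i)) => [?|?|<-]; split; lra.
have w0 : forall i, (i < m)%N -> w i = 0.
  apply: (@interval_increments_independent _ _ u v).
  - by move=> i im; rewrite /u /v; case: (ltgtP (b i) (c i)) => //; rewrite ltrDl.
  - move=> i im; have [vb vc] := v_le i (ltnW (ltnW im)); rewrite le_min.
    by rewrite (le_trans vb (gap_b _ _ _ (ltnW im))) ?(le_trans vc (gap_c _ _ _ (ltnW im))).
  - move=> p sp; under eq_bigr do rewrite wP mulrBr.
    have := weights_moment solc sp; rewrite -(weights_moment solb sp) => /eqP.
    (* Both last nodes are 1, so the term of index [m] cancels and [m] increments remain. *)
    rewrite -subr_eq0 -sumrB big_ord_recr /= bm cm subrr addr0 => /eqP.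
    exact.
move=> i; rewrite leq_eqVlt => /predU1P[->|im]; first by rewrite bm cm.
have := w0 i im; rewrite /w; case: (ltgtP (b i) (c i)) => // _ /eqP; rewrite ?oppr_eq0;
  by rewrite (negPf (weights_neq0 solb (ltnW im))).
Qed.

End NodesWithWeights.

(** The nodes lie in (0, 1]. If this interval is cut into cells of width [delta], two solutions with
    the same cells differ by less than [delta] at each node, hence coincide. *)
Lemma nodes_finite (R : realType) (m : nat) (K : nat -> R) :
  finitely_many (fun t : R => exists b, nodes_with_weights m K b /\
    exists i : 'I_m.+1, t = b i).
Proof.
have [ex_sol|no_sol] := pselect (exists b, nodes_with_weights m K b); last first.
  by exists [::] => t [b [solb _]]; case: no_sol; exists b.
have [delta delta0 gap] := nodes_gap ex_sol.
pose cell (b : nat -> R) : {ffun 'I_m.+1 -> 'I_(Num.truncn delta^-1).+1} :=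
  [ffun i : 'I_m.+1 => inord (Num.truncn (b i / delta))].
have [|rep repP] := @finite_representatives _ _ (nodes_with_weights m K) cell
    (fun b c => forall i, (i <= m)%N -> b i = c i).
  move=> b c solb solc cell_bc.
  apply: (close_nodes_eq delta0 solb solc (gap b solb) (gap c solc)) => i im.
  have := congr1 (fun f : {ffun _ -> _} => val (f (Ordinal (im : (i < m.+1)%N)))) cell_bc.
  have bnd (x : R) : 0 < x -> x <= 1 ->
      (Num.truncn (x / delta) < (Num.truncn delta^-1).+1)%N.
    by move=> x0 x1; rewrite ltnS; apply: le_truncn; rewrite -[leRHS]mul1r ler_pM2r ?invr_gt0.
  have b0 := nodes_gt0 solb im; have c0 := nodes_gt0 solc im.
  rewrite !ffunE /= !inordK ?bnd ?(nodes_le1 solb) ?(nodes_le1 solc) // => tr.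
  have /truncn_itv/andP[] : 0 <= b i / delta by rewrite divr_ge0 ?ltW.
  have /truncn_itv/andP[] : 0 <= c i / delta by rewrite divr_ge0 ?ltW.
  rewrite tr -natr1 !ler_pdivlMr // !ltr_pdivrMr // => ? ? ? ?.
  by rewrite ler_norml; apply/andP; split; lra.
have /finitely_many_union [L LP] (vi : {ffun 'I_m.+1 -> 'I_(Num.truncn delta^-1).+1} * 'I_m.+1) :
    finitely_many (fun t : R => exists2 b, rep vi.1 = Some b & t = b vi.2).
  case: vi => v i /=; case: (rep v) => [b|]; last by exists [::] => t [].
  by exists [:: b i] => t [_ [<-] ->]; rewrite mem_head.
exists L => t [b [solb [i ->]]]; have [c rc bc] := repP b solb.
by apply: LP; exists (cell b, i); exists c => //=; apply/bc/leq_ord.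
Qed.

(** * Rank bounds for polynomials in squared distances *)

Section MonomialSpan.
Context (R : fieldType) (n : nat) (f : nat -> 'rV[R]_n).
Local Notation D i := (diag_mx (f i)).

(* Functions on n points are row vectors, and multiplication by f i is the matrix [D i].
   [monomial_span v e] is spanned by the monomials of degree at most e in f 0, .., f (v - 1). *)
Fixpoint monomial_span (v : nat) : nat -> 'M[R]_n :=
  if v is v'.+1 then
    fix span_v e :=
      if e is e'.+1 then (monomial_span v' e'.+1 + span_v e' *m D v')%MS
      else <<const_mx 1 : 'rV_n>>%MS
  else fun=> <<const_mx 1 : 'rV_n>>%MS.

Lemma monomial_spanv0 v : monomial_span v 0 = <<const_mx 1 : 'rV_n>>%MS.
Proof. by case: v. Qed.

Lemma monomial_spanSS v e : monomial_span v.+1 e.+1 =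
  (monomial_span v e.+1 + monomial_span v.+1 e *m D v)%MS.
Proof. by []. Qed.

(** The recursion of [monomial_span] is Pascal's rule, and multiplication by [D v] does not raise
    the rank. *)
Lemma rank_monomial_span v e : (\rank (monomial_span v e) <= 'C(v + e, e))%N.
Proof.
elim: v e => [|v IHv] e; first by rewrite /= mxrank_gen add0n binn rank_leq_row.
elim: e => [|e IHe]; first by rewrite monomial_spanv0 mxrank_gen bin0 rank_leq_row.
rewrite monomial_spanSS addSn binS; apply: leq_trans (mxrank_adds_leqif _ _) _.
apply: leq_add; first exact: IHv.
by apply: leq_trans (mxrankM_maxl _ _) _; rewrite addnS -addSn.
Qed.

Lemma monomial_span_le v e : (monomial_span v e <= monomial_span v e.+1)%MS.
Proof.
elim: v e => [|v IHv] e //; elim: e => [|e IHe].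
  rewrite monomial_spanSS monomial_spanv0 -(monomial_spanv0 v).
  exact: submx_trans (IHv 0) (addsmxSl _ _).
by rewrite !monomial_spanSS addsmxS // submxMr.
Qed.

Lemma monomial_span_leS v e : (monomial_span v e <= monomial_span v.+1 e)%MS.
Proof. by case: e => [|e]; rewrite ?monomial_spanv0 // monomial_spanSS addsmxSl. Qed.

Lemma diag_mxC (u w : 'rV[R]_n) : diag_mx u *m diag_mx w = diag_mx w *m diag_mx u.
Proof. by rewrite !mulmx_diag; congr diag_mx; apply/rowP => j; rewrite !mxE mulrC. Qed.

Lemma monomial_span_mul v e i : (i < v)%N ->
  (monomial_span v e *m D i <= monomial_span v e.+1)%MS.
Proof.
elim: v e => // v IHv e; rewrite ltnS leq_eqVlt => /predU1P[->|iv].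
  by rewrite monomial_spanSS addsmxSr.
elim: e => [|e IHe].
  rewrite monomial_spanv0 -(monomial_spanv0 v).
  exact: submx_trans (IHv 0 iv) (monomial_span_leS _ _).
rewrite monomial_spanSS addsmxMr addsmx_sub.
rewrite (submx_trans (IHv _ iv) (monomial_span_leS _ _)) andTb.
rewrite -mulmxA diag_mxC mulmxA monomial_spanSS.
by apply: submx_trans (addsmxSr _ _); apply: submxMr.
Qed.

(* Since (f d)^2 is a combination of f 0 and the (f i)^2 with 0 < i < d, the exponent of f d
   is kept at most 1 in the products of f 0, .., f d. *)
Definition reduced_span (d e : nat) : 'M[R]_n :=
  if e is e'.+1 then (monomial_span d e + monomial_span d e' *m D d)%MS
  else monomial_span d 0.

Lemma rank_reduced_span d e : (0 < e)%N ->
  (\rank (reduced_span d e) <= 'C(d + e, e) + 'C(d + e - 1, e - 1))%N.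
Proof.
case: e => // e _; rewrite addnS !subn1 /=.
apply: leq_trans (mxrank_adds_leqif _ _) _; rewrite -addnS.
apply: leq_add; first exact: rank_monomial_span.
exact: leq_trans (mxrankM_maxl _ _) (rank_monomial_span _ _).
Qed.

Lemma reduced_span_le d e : (reduced_span d e <= reduced_span d e.+1)%MS.
Proof.
case: e => [|e] /=; first exact: submx_trans (monomial_span_le _ _) (addsmxSl _ _).
by rewrite addsmxS ?submxMr ?monomial_span_le.
Qed.

Lemma reduced_span_mono d e e' : (e <= e')%N -> (reduced_span d e <= reduced_span d e')%MS.
Proof.
elim: e' => [|e' IHe']; first by rewrite leqn0 => /eqP->.
rewrite leq_eqVlt => /predU1P[->//|/IHe' H].
exact: submx_trans H (reduced_span_le _ _).
Qed.

(** Only the factor [f d] can create a square of [f d]; the relation replaces it by terms of degree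
    at most 2 in [f 0], .., [f (d - 1)]. *)
Lemma reduced_span_mul d e i : (0 < d)%N ->
  D d *m D d = D 0 - \sum_(1 <= k < d) D k *m D k ->
  (i <= d)%N -> (reduced_span d e *m D i <= reduced_span d e.+1)%MS.
Proof.
move=> d0 sq_d; rewrite leq_eqVlt => /predU1P[->|id]; last first.
  have H e0 := submx_trans (monomial_span_mul e0 id)
    (addsmxSl _ (monomial_span d e0 *m D d)).
  case: e => [|e] /=; first exact: H.
  rewrite addsmxMr addsmx_sub; apply/andP; split; first exact: H.
  rewrite -mulmxA diag_mxC mulmxA; apply: submx_trans (addsmxSr _ _).
  by apply: submxMr; apply: monomial_span_mul.
case: e => [|e] /=; first exact: addsmxSr.
rewrite addsmxMr addsmx_sub addsmxSr /= -mulmxA sq_d mulmxBr mulmx_sumr.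
apply: submx_trans (addsmxSl _ _).
apply: addmx_sub.
  by apply: submx_trans (monomial_span_le _ _); apply: monomial_span_mul.
rewrite -scaleN1r big_nat; apply: scalemx_sub; apply: summx_sub => k /andP[_ kd].
rewrite mulmxA; apply: submx_trans (monomial_span_mul _ kd).
by apply: submxMr; apply: monomial_span_mul.
Qed.

(** Each power of [l] is the previous one times an affine combination of the [f i], which raises the
    degree by at most 1. *)
Lemma reduced_span_horner d e (l : 'rV[R]_n) (p : {poly R}) (a : R) (c : nat -> R) : (0 < d)%N ->
  D d *m D d = D 0 - \sum_(1 <= k < d) D k *m D k ->
  l = a *: const_mx 1 + \sum_(i < d.+1) c i *: f i -> (size p <= e.+1)%N ->
  (\row_j p.[l 0 j] <= reduced_span d e)%MS.
Proof.
move=> d0 sq_d lE sp.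
have diag_l : diag_mx l = a *: 1%:M + \sum_(i < d.+1) c i *: D i.
  rewrite lE linearD linearZ /= linear_sum /= diag_const_mx; congr (_ + _).
  by apply: eq_bigr => i _; rewrite linearZ.
have powers i : (\row_j (l 0 j) ^+ i <= reduced_span d i)%MS.
  elim: i => [|i IHi].
    rewrite /= monomial_spanv0 genmxE.
    by have -> : \row_j l 0 j ^+ 0 = const_mx 1 by apply/rowP => j; rewrite !mxE expr0.
  have -> : \row_j l 0 j ^+ i.+1 = (\row_j l 0 j ^+ i) *m diag_mx l.
    by rewrite mul_mx_diag; apply/rowP => j; rewrite !mxE exprSr.
  apply: submx_trans (submxMr _ IHi) _; rewrite diag_l mulmxDr -scalemxAr mulmx1 mulmx_sumr.
  apply: addmx_sub; first exact: scalemx_sub (reduced_span_le _ _).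
  apply: summx_sub => k _; rewrite -scalemxAr; apply: scalemx_sub.
  by apply: reduced_span_mul d0 sq_d _; rewrite -ltnS.
have -> : \row_j p.[l 0 j] = \sum_(i < size p) p`_i *: \row_j (l 0 j) ^+ i.
  apply/rowP => j; rewrite summxE !mxE horner_coef.
  by apply: eq_bigr => i _; rewrite !mxE.
apply: summx_sub => i _; apply/scalemx_sub/(submx_trans (powers i))/reduced_span_mono.
by rewrite -ltnS; apply: leq_trans sp.
Qed.

End MonomialSpan.

Definition sqdist (R : pzRingType) (d : nat) (x y : 'rV[R]_d) : R :=
  \sum_(i < d) (x ord0 i - y ord0 i) ^+ 2.

Definition distance_poly_bound (d e : nat) : nat := ('C(d + e, e) + 'C(d + e - 1, e - 1))%N.

(* |x - y|^2 = |x|^2 + |y|^2 - 2 sum x_k y_k is affine in |y|^2, y_1, .., y_d, and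
   y_d^2 = |y|^2 - y_1^2 - .. - y_(d-1)^2. *)
Lemma rank_sqdist_poly (R : fieldType) (d n e : nat) (z : 'I_n -> 'rV[R]_d) (p : {poly R}) :
  (0 < d)%N -> (0 < e)%N -> (size p <= e.+1)%N ->
  (\rank (\matrix_(i, j) p.[sqdist (z i) (z j)]) <= distance_poly_bound d e)%N.
Proof.
case: d z => // d z _ e0 sp.
(* [f 0] is the squared norm and [f k.+1] the coordinate [k], so the last coordinate plays the role
   of [f d] in the relation. *)
pose f k : 'rV[R]_n := if k is k'.+1 then \row_j z j 0 (inord k') else \row_j sqdist (z j) 0.
apply: leq_trans (rank_reduced_span f d.+1 e0); apply: mxrankS; apply/row_subP => i.
have sqE j : sqdist (z j) 0 = \sum_(k < d.+1) z j 0 k ^+ 2.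
  by apply: eq_bigr => k _; rewrite mxE subr0.
have -> : row i (\matrix_(i, j) p.[sqdist (z i) (z j)]) =
    \row_j p.[(\row_j sqdist (z i) (z j)) 0 j].
  by apply/rowP => j; rewrite !mxE.
pose c k : R := if k is k'.+1 then - (z i 0 (inord k') *+ 2) else 1.
apply: (@reduced_span_horner _ _ f d.+1 e _ p (sqdist (z i) 0) c) => //.
  rewrite mulmx_diag; under eq_bigr do rewrite mulmx_diag.
  rewrite -linear_sum -linearB; congr diag_mx; apply/rowP => j.
  rewrite !mxE summxE big_add1 /= big_mkord sqE big_ord_recr /=.
  under [X in _ - X]eq_bigr => k _ do
    rewrite !mxE -expr2 -[inord k]/(inord (widen_ord (leqnSn d) k)) inord_val.
  by rewrite addrAC subrr add0r -expr2 -[inord d]/(inord (ord_max : 'I_d.+1)) inord_val.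
apply/rowP => j; rewrite !mxE mulr1 summxE big_ord_recl !mxE mul1r addrA !sqE.
rewrite -big_split -big_split /=.
apply: eq_bigr => k _; by rewrite !mxE /= inord_val; ring.
Qed.

(** * Reflections and extension of isometries *)

Section Isometries.
Context (R : realFieldType) (d : nat).
Implicit Types (u v w x y z p q : 'rV[R]_d).

Definition dot u v : R := \sum_(i < d) u 0 i * v 0 i.

Lemma dotC u v : dot u v = dot v u.
Proof. by apply: eq_bigr => i _; rewrite mulrC. Qed.

Lemma dotBl u v w : dot (u - v) w = dot u w - dot v w.
Proof. by rewrite -sumrB; apply: eq_bigr => i _; rewrite !mxE mulrBl. Qed.

Lemma dotZl a u v : dot (a *: u) v = a * dot u v.
Proof. by rewrite mulr_sumr; apply: eq_bigr => i _; rewrite !mxE mulrA. Qed.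

Lemma dotBr u v w : dot w (u - v) = dot w u - dot w v.
Proof. by rewrite dotC dotBl !(dotC w). Qed.

Lemma dotZr a u v : dot u (a *: v) = a * dot u v.
Proof. by rewrite dotC dotZl dotC. Qed.

Lemma dot_sub_scale w v a :
  dot (w - a *: v) (w - a *: v) = dot w w - 2 * a * dot w v + a ^+ 2 * dot v v.
Proof. by rewrite !(dotBl, dotBr, dotZl, dotZr) [dot v w]dotC; ring. Qed.

Lemma sqdistE x y : sqdist x y = dot (x - y) (x - y).
Proof. by apply: eq_bigr => i _; rewrite !mxE expr2. Qed.

Lemma sqdist_eq0 x y : (sqdist x y == 0) = (x == y).
Proof.
apply/eqP/eqP => [H|->]; last by apply: big1 => i _; rewrite subrr expr0n.
apply/rowP => i; apply/eqP; rewrite -subr_eq0 -sqrf_eq0.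
by rewrite (psumr_eq0P _ H) // => j _; apply: sqr_ge0.
Qed.

Lemma sqdist_scale a x y : sqdist (a *: x) (a *: y) = a ^+ 2 * sqdist x y.
Proof. by rewrite !sqdistE -scalerBr dotZl dotZr mulrA. Qed.

Lemma sqdist_ge0 x y : 0 <= sqdist x y.
Proof. by apply: sumr_ge0 => i _; apply: sqr_ge0. Qed.

(* The reflection in the perpendicular bisector of p and q. *)
Lemma bisector_reflection p q : exists r : 'rV[R]_d -> 'rV[R]_d,
  [/\ forall x y, sqdist (r x) (r y) = sqdist x y, r p = q
    & forall z, sqdist z p = sqdist z q -> r z = z].
Proof.
have [->|pq] := eqVneq p q; first by exists id.
pose v := p - q; have vv0 : dot v v != 0 by rewrite -sqdistE sqdist_eq0.
(* The numerator is [|z - q|^2 - |z - p|^2]; it vanishes on the bisector, and [t p = 1]. *)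
pose t z := (2 * dot z v - (dot p p - dot q q)) / dot v v.
exists (fun z => z - t z *: v); split.
- move=> x y; pose w := x - y.
  (* The images of [x] and [y] differ by the linear reflection of [w] along [v]. *)
  have -> : x - t x *: v = y - t y *: v + (w - (2 * dot w v / dot v v) *: v).
    have -> : t x = t y + 2 * dot w v / dot v v by rewrite /t /w dotBl; field.
    by rewrite /w scalerDl opprD addrACA [y + _]addrC subrK.
  rewrite !sqdistE addrC addKr -/w.
  by rewrite dot_sub_scale; field.
- have -> : t p = 1.
    rewrite /t; have -> : 2 * dot p v - (dot p p - dot q q) = dot v v.
      by rewrite /v !(dotBl, dotBr) [dot q p]dotC; ring.
    by rewrite divff.
  by rewrite scale1r /v opprB addrC subrK.
- move=> z; rewrite !sqdistE !(dotBl, dotBr) => zpq.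
  suff -> : t z = 0 by rewrite scale0r subr0.
  rewrite /t /v !(dotBl, dotBr); apply/eqP; rewrite mulf_eq0; apply/orP; left.
  by apply/eqP; move: zpq; rewrite [dot p z]dotC [dot q z]dotC; lra.
Qed.

(** Points are matched one at a time. The earlier [y i] are equidistant from [f (x n)] and [y n], so
    the reflection exchanging these two fixes them. *)
Lemma isometry_extension n (x y : nat -> 'rV[R]_d) :
  (forall i j, (i < n)%N -> (j < n)%N -> sqdist (x i) (x j) = sqdist (y i) (y j)) ->
  exists f : 'rV[R]_d -> 'rV[R]_d,
    (forall u v, sqdist (f u) (f v) = sqdist u v) /\ forall i, (i < n)%N -> f (x i) = y i.
Proof.
elim: n => [_|n IHn xy]; first by exists id.
have [i j im jm|f [f_iso fx]] := IHn; first by rewrite xy // ltnW.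
have [r [r_iso rn r_fix]] := bisector_reflection (f (x n)) (y n).
exists (r \o f); split=> [u v|i]; first by rewrite /= r_iso f_iso.
rewrite ltnS leq_eqVlt => /predU1P[->//|im] /=.
rewrite fx // r_fix // -{1}fx // f_iso; apply: xy => //; exact: ltnW.
Qed.

End Isometries.

(** * Bounded cardinality and finitely many normalised distances *)

(** The polynomial [p] is 1 at 0 and vanishes at every [b k], so its matrix on the squared distances
    is the identity, of rank [n]. *)
Lemma card_le_of_distances (R : fieldType) (d n m : nat) (z : 'I_n -> 'rV[R]_d) (b : nat -> R) :
  (0 < d)%N -> (forall k : 'I_m.+1, b k != 0) ->
  (forall i j, i != j -> exists k : 'I_m.+1, sqdist (z i) (z j) = b k) ->
  (n <= distance_poly_bound d m.+1)%N.
Proof.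
move=> d0 b0 dist_b; pose p : {poly R} := \prod_(k < m.+1) (1 - (b k)^-1 *: 'X).
have pE x : p.[x] = \prod_(k < m.+1) (1 - x / b k).
  by rewrite horner_prod; apply: eq_bigr => k _; rewrite !hornerE mulrC.
have sp : (size p <= m.+2)%N.
  apply: leq_trans (size_prod_linear _) _; last by rewrite cardT size_enum_ord.
  move=> k _; apply: leq_trans (size_polyD _ _) _; rewrite size_polyN geq_max size_poly1 /=.
  by apply: leq_trans (size_scale_leq _ _) _; rewrite size_polyX.
apply: leq_trans (rank_sqdist_poly z d0 (ltn0Sn m) sp).
have -> : \matrix_(i, j) p.[sqdist (z i) (z j)] = 1%:M.
  apply/matrixP => i j; rewrite !mxE; have [->|ij] := eqVneq i j.
    have -> : sqdist (z j) (z j) = 0 by apply: big1 => k _; rewrite subrr expr0n.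
    by rewrite pE big1 // => k _; rewrite mul0r subr0.
  by have [k ->] := dist_b i j ij; rewrite pE (bigD1 k) //= divff // subrr mul0r.
by rewrite mxrank1.
Qed.

(* The matrix of a Lagrange basis polynomial at the squared distances is K I + A, with A the
   adjacency matrix of one distance; it is singular since its rank is less than n. *)
Lemma weight_eigenvalue (R : fieldType) (d n m : nat) (z : 'I_n -> 'rV[R]_d) (b : nat -> R)
    (i : nat) :
  (0 < d)%N -> (0 < m)%N -> (distance_poly_bound d m < n)%N ->
  {in gtn m.+1 &, injective b} -> (i <= m)%N ->
  (forall i j, i != j -> exists k : 'I_m.+1, sqdist (z i) (z j) = b k) ->
  exists A : 'M[bool]_n,
    root (char_poly (- map_mx (fun c : bool => c%:R) A)) (lagrange_basis m b i).[0].
Proof.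
move=> d0 m0 n_gt b_inj im dist_b.
pose A : 'M[bool]_n := \matrix_(p, q) ((p != q) && (sqdist (z p) (z q) == b i)).
(* With [-A] the eigenvalue is the weight itself, without a sign. *)
exists A; rewrite -eigenvalue_root_char /eigenvalue /eigenspace kermx_eq0 /row_free.
rewrite neq_ltn; apply/orP; left; apply: leq_ltn_trans n_gt.
apply: leq_trans (rank_sqdist_poly z d0 m0 (size_lagrange_basis b im)).
rewrite -opprD mxrank_opp; apply: eq_leq; congr (\rank _).
apply/matrixP => p q; rewrite !mxE; have [->|pq] := eqVneq p q.
  by rewrite add0r; congr horner; symmetry; apply: big1 => k _; rewrite subrr expr0n.
have [k ->] := dist_b p q pq; rewrite lagrange_basis_node ?leq_ord // addr0; congr (nat_of_bool _)%:R.
rewrite andTb; apply/idP/idP => [/eqP/b_inj->|/eqP->] //.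
exact: (ltn_ord k).
Qed.

Definition normalized_distances (R : realFieldType) (d n m : nat) (z : 'I_n -> 'rV[R]_d)
    (b : nat -> R) : Prop :=
  [/\ forall i j, (i < j)%N -> (j <= m)%N -> b i < b j, 0 < b 0, b m = 1
    & forall i j, i != j -> exists k : 'I_m.+1, sqdist (z i) (z j) = b k].

Lemma normalized_distances_card (R : realFieldType) (d n m : nat) (z : 'I_n -> 'rV[R]_d) b :
  (0 < d)%N -> normalized_distances m z b -> (n <= distance_poly_bound d m.+1)%N.
Proof.
move=> d0 [b_lt b0 _ dist_b]; apply: card_le_of_distances d0 _ dist_b => -[[|k] km] /=.
  by rewrite gt_eqF.
by rewrite gt_eqF // (lt_trans b0) // b_lt.
Qed.

Lemma char_roots_finite (R : rcfType) (n : nat) (A : 'M[R]_n) :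
  finitely_many (root (char_poly A)).
Proof.
exists (rootsR (char_poly A)) => t t0.
have p0 : char_poly A != 0 by rewrite monic_neq0 ?char_poly_monic.
by have := roots_on_rootsR p0 t; rewrite in_itv /= t0 => <-.
Qed.

Lemma normalized_distances_finite (R : realType) (d m : nat) : (0 < d)%N -> (0 < m)%N ->
  finitely_many (fun t : R => exists n (z : 'I_n -> 'rV[R]_d) b,
    [/\ (distance_poly_bound d m < n)%N, normalized_distances m z b
      & exists k : 'I_m.+1, t = b k]).
Proof.
move=> d0 m0; pose N := distance_poly_bound d m.+1.
have [L LP] : finitely_many (fun t : R => exists (n : 'I_N.+1) (A : 'M[bool]_n),
    root (char_poly (- map_mx (fun c : bool => c%:R) A)) t).
  by do 2!apply: finitely_many_union => ?; apply: char_roots_finite.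
(* All weights lie in [L], so a weight sequence is coded by [m.+1] positions in [L]. *)
have /finitely_many_union [B BP] (f : {ffun 'I_m.+1 -> 'I_(size L)}) :=
  nodes_finite m (fun i => L`_(f (inord i))).
exists B => t [n [z [b [n_gt zb [k tk]]]]]; apply: BP.
have [b_lt b0 bm dist_b] := zb.
have n_le : (n < N.+1)%N by apply: normalized_distances_card zb.
have KL (i : 'I_m.+1) : (lagrange_basis m b i).[0] \in L.
  have [A rootA] := weight_eigenvalue d0 m0 n_gt (nodes_inj b_lt) (leq_ord i) dist_b.
  by apply: LP; exists (Ordinal n_le), A.
have KL_lt (i : 'I_m.+1) : (index (lagrange_basis m b i).[0] L < size L)%N by rewrite index_mem.
exists [ffun i => Ordinal (KL_lt i)]; exists b; split; last by exists k.
by split=> // i im; rewrite ffunE /= nth_index // inordK.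
Qed.

(** * Normalisation by the diameter, similarity and the final count *)

Definition diameter (R : realType) (d : nat) (X : {fset 'rV[R]_d}) : R :=
  (sort <=%R (dist_set X))`_(#|` dist_set X|.-1).

Lemma normalize_distance_set (R : realType) (d m : nat) (X : {fset 'rV[R]_d}) :
  is_s_distance_set m.+1 X ->
  0 < diameter X /\ exists b, normalized_distances m
    (fun i : 'I_#|` X| => (diameter X)^-1 *: (enum_fset X)`_i) b.
Proof.
move=> sX; pose a := sort <=%R (dist_set X).
have size_a : size a = m.+1 by rewrite size_sort.
have diamE : diameter X = a`_m by rewrite /diameter sX.
have a_lt i j : (i < j)%N -> (j <= m)%N -> a`_i < a`_j.
  move=> ij jm; apply: (sorted_ltn_nth lt_trans) => //.
  - by rewrite sort_lt_sorted fset_uniq.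
  - by rewrite inE size_a ltnS (leq_trans (ltnW ij)).
  - by rewrite inE size_a.
have a_gt0 i : (i <= m)%N -> 0 < a`_i.
  move=> im; have : a`_i \in dist_set X by rewrite -(mem_sort <=%R) mem_nth ?size_a.
  case/imfset2P => x /= _ [y /=]; rewrite !inE => /andP[_ xy] ->.
  by rewrite /edist sqrtr_gt0 lt0r sqdist_ge0 sqdist_eq0 xy.
have diam0 : 0 < diameter X by rewrite diamE a_gt0.
split=> //; exists (fun k => (a`_k / diameter X) ^+ 2); split.
- move=> i j ij jm; have b_gt0 k : (k <= m)%N -> 0 < a`_k / diameter X.
    by move=> km; apply: divr_gt0 => //; apply: a_gt0.
  rewrite ltr_pXn2r // ?nnegrE; try by apply/ltW/b_gt0; lia.
  by rewrite ltr_pM2r ?invr_gt0 //; apply: a_lt.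
- by apply/exprn_gt0/divr_gt0 => //; apply: a_gt0.
- by rewrite /= -diamE divff ?expr1n // gt_eqF.
move=> i j ij; pose x := (enum_fset X)`_i; pose y := (enum_fset X)`_j.
have : edist x y \in dist_set X.
  apply/imfset2P; exists x; first by rewrite /= mem_nth.
  exists y => //=; rewrite !inE mem_nth //=.
  by rewrite nth_uniq ?fset_uniq.
rewrite -(mem_sort <=%R) => /(nthP 0)[k]; rewrite -/a size_a => km ak.
exists (Ordinal km); rewrite /= ak sqdist_scale exprMn mulrC; congr (_ * _).
by rewrite /edist sqr_sqrtr ?sqdist_ge0.
Qed.

(** [X] is scaled by [a / b], then an isometry carries its enumeration to that of [Y]. *)
Lemma similar_of_proportional (R : realType) (d : nat) (X Y : {fset 'rV[R]_d}) (a b : R) :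
  0 < a -> 0 < b -> #|` X| = #|` Y| ->
  (forall i j, (i < #|` X|)%N -> (j < #|` X|)%N ->
    sqdist (a *: (enum_fset X)`_i) (a *: (enum_fset X)`_j) =
    sqdist (b *: (enum_fset Y)`_i) (b *: (enum_fset Y)`_j)) ->
  similar_sets X Y.
Proof.
move=> a0 b0 cardXY XY; pose c := a / b; have c0 : 0 < c by rewrite divr_gt0.
have [|f [f_iso fX]] := @isometry_extension _ _ #|` X| (fun i => c *: (enum_fset X)`_i)
    (fun i => (enum_fset Y)`_i).
  move=> i j iX jX; rewrite /c mulrC -!scalerA sqdist_scale XY // -sqdist_scale !scalerA.
  by rewrite mulVf ?scale1r // gt_eqF.
exists (fun x => f (c *: x)), c; split=> //; split.
  move=> x y; rewrite /edist -!/(sqdist _ _) f_iso sqdist_scale.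
  by rewrite sqrtrM ?sqr_ge0 // sqrtr_sqr ger0_norm // ltW.
apply/fsetP => y; apply/imfsetP/idP => [[x /= xX ->]|yY].
  have iX : (index x (enum_fset X) < #|` X|)%N by rewrite index_mem.
  by have := fX _ iX; rewrite nth_index // => ->; apply: mem_nth; rewrite -cardXY.
have iY : (index y (enum_fset Y) < #|` X|)%N by rewrite cardXY index_mem.
by exists (enum_fset X)`_(index y (enum_fset Y)); rewrite /= ?mem_nth // fX // nth_index.
Qed.

Theorem theorem4p4 (R : realType) (s d : nat) (hs : (2 <= s)%N) (hd : (1 <= d)%N) :
  exists reps : seq {fset 'rV[R]_d},
    forall X : {fset 'rV[R]_d},
      is_s_distance_set s X ->
      (2 * 'C(d + s - 1, s - 1) + 2 * 'C(d + s - 2, s - 2) <= #|` X|)%N ->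
      exists2 Y, Y \in reps & similar_sets X Y.
Proof.
case: s hs => [|[|m]] // _; rewrite !addnS !subSS !subn0.
set M := m.+1; pose N := distance_poly_bound d M.+1.
have [L LP] := @normalized_distances_finite R d M hd isT.
pose large (X : {fset 'rV[R]_d}) :=
  is_s_distance_set M.+1 X /\ (distance_poly_bound d M < #|` X|)%N.
pose normdist (X : {fset 'rV[R]_d}) (i j : nat) :=
  sqdist ((diameter X)^-1 *: (enum_fset X)`_i) ((diameter X)^-1 *: (enum_fset X)`_j).
have cardN X : large X -> (#|` X| <= N)%N.
  by move=> [sX _]; have [_ [b]] := normalize_distance_set sX; apply: normalized_distances_card.
(* The entry 0 added to [L] covers [i = j]. *)
have [B normdistB] : exists B : seq R, forall X i j, large X ->
    (i < #|` X|)%N -> (j < #|` X|)%N -> normdist X i j \in B.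
  exists (0 :: L) => X i j [sX X_gt] iX jX; have [->|ij] := eqVneq i j.
    by rewrite /normdist (eqP (_ : sqdist _ _ == 0)) ?mem_head // sqdist_eq0.
  have [_ [b Xb]] := normalize_distance_set sX; rewrite inE; apply/orP; right; apply: LP.
  exists #|` X|, (fun i : 'I_#|` X| => (diameter X)^-1 *: (enum_fset X)`_i), b; split=> //.
  by have [_ _ _ distb] := Xb; apply: (distb (Ordinal iX) (Ordinal jX)).
(* The distance matrix is stored as positions in [B], in a square of fixed size [N] so that all
   cardinalities share one finite type. Only indices below the cardinality are compared. *)
pose inv X : 'I_N.+1 * {ffun 'I_N * 'I_N -> 'I_(size B).+1} :=
  (inord #|` X|, [ffun ij : 'I_N * 'I_N => inord (index (normdist X ij.1 ij.2) B)]).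
have [|rep repP] := @finite_representatives _ _ large inv (@similar_sets R d).
  move=> X Y lX lY [/(congr1 val)]; rewrite /= !inordK ?ltnS ?cardN // => cardXY.
  move=> /ffunP dXY; have [sX _] := lX; have [sY _] := lY.
  have [dX _] := normalize_distance_set sX; have [dY _] := normalize_distance_set sY.
  apply: (@similar_of_proportional _ _ _ _ (diameter X)^-1 (diameter Y)^-1);
    rewrite ?invr_gt0 // => i j iX jX.
  have [iY jY] : (i < #|` Y|)%N /\ (j < #|` Y|)%N by rewrite -cardXY.
  have iN := leq_trans iX (cardN X lX); have jN := leq_trans jX (cardN X lX).
  have nX := normdistB X i j lX iX jX; have nY := normdistB Y i j lY iY jY.
  have := congr1 val (dXY (Ordinal iN, Ordinal jN)).
  rewrite !ffunE /= !inordK ?ltnS ?index_size // => /(congr1 (nth 0 B)).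
  by rewrite !nth_index.
exists (pmap rep (enum {: 'I_N.+1 * {ffun 'I_N * 'I_N -> 'I_(size B).+1}})).
move=> X sX cardX; have /repP [Y repY XY] : large X.
  split=> //; apply: leq_trans cardX; rewrite /distance_poly_bound !addnS !subSS !subn0.
  (* The assumed size is twice [distance_poly_bound d M], and twice a positive number exceeds it. *)
  have := bin_gt0 (d + m).+1 m.+1; rewrite -/M; lia.
exists Y => //; rewrite mem_pmap; apply/mapP; exists (inv X) => //.
by rewrite mem_enum.
Qed.
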